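(* Let $f_1,\dots,f_N:\mathbb{R}^n\to\mathbb{R}$ satisfy (H1) and (H2) stated in the context, and suppose each $f_j$ is strictly convex. Then the sequence $(x_k)$ generated by Algorithm X described in the context converges to the global minimum point of $\Phi$.
   Context: (H1): there is $M\in\mathbb{R}$ with $f_j(x)\ge M$ for all $x\in\mathbb{R}^n$ and $1\le j\le N$. (H2): each $f_j\in C^1(\mathbb{R}^n)$ and there is a modulus of continuity $w$ (increasing $w:[0,\infty)\to[0,\infty)$, $w(0)=0$, continuous at $0$) with $\|\nabla f_j(x)-\nabla f_j(y)\|\le w(\|x-y\|)$ for all $x,y$ and $j$. Let $\Phi(x)=\max_{1\le j\le N}f_j(x)$, and $g'(x;d)=\lim_{t\to0^+}\frac{g(x+td)-g(x)}{t}$ denotes the directional derivative. Algorithm X: set $x_0=0$, $c=\sigma=\tfrac12$. At iteration $k=0,1,2,\dots$: let $G\in\mathbb{R}^{N\times n}$ have $j$-th row $\nabla f_j(x_k)^T$, $f=(f_1(x_k),\dots,f_N(x_k))^T$; let $\lambda$ be a solution of $\min_\lambda(\tfrac12\lambda^TGG^T\lambda-f^T\lambda)$ subject to $\sum_i\lambda_i=1$, $\lambda_i\ge0$; set $p_k=-G^T\lambda$, and $d_k=0$ if $p_k=0$, otherwise $d_k=p_k/\|p_k\|$. If $d_k=0$ set $\alpha_k=1$; otherwise $\alpha_k=\sigma^j$ with $j$ the smallest nonnegative integer such that $\Phi(x_k+\sigma^jd_k)<\Phi(x_k)+c\sigma^j\Phi'(x_k;d_k)$. Set $x_{k+1}=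x_k+\alpha_kd_k$.
   Formalization: The existence of a global minimum point of Φ is added as a hypothesis, since it can fail under (H1), (H2) and strict convexity (e.g. n=N=1, f(x)=√(1+x²)−x has no minimizer). *)

(* Defs.v *)
From HB Require Import structures.
From mathcomp Require Import all_boot all_order all_algebra.
From mathcomp Require Import all_classical all_reals all_analysis.
Set Implicit Arguments. Unset Strict Implicit. Unset Printing Implicit Defensive.
Import Order.TTheory GRing.Theory Num.Theory.
Import numFieldNormedType.Exports.
Local Open Scope classical_set_scope.
Local Open Scope ring_scope.

Section Defs.
Variable R : realType.

Definition enorm (n : nat) (v : 'cV[R]_n) : R := Num.sqrt (\sum_(i < n) (v i 0) ^+ 2).

Definition grad (n : nat) (f : 'cV[R]_n -> R) (x : 'cV[R]_n) : 'cV[R]_n :=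
  \col_(i < n) ('d f x (delta_mx i 0 : 'cV[R]_n) : R).

(* Phi(x) = max_{1<=j<=N+1} f_j(x)  (functions indexed by 'I_N.+1, so at least one). *)
Definition Phi (n N : nat) (f : 'I_N.+1 -> 'cV[R]_n -> R) (x : 'cV[R]_n) : R :=
  \big[Num.max/f ord0 x]_(j < N.+1) f j x.

Definition modulus (w : R -> R) : Prop :=
  (forall a b, 0 <= a -> a <= b -> w a <= w b) /\ w 0 = 0 /\ (w t @[t --> 0^'+] --> 0).

Definition strictly_convex (n : nat) (g : 'cV[R]_n -> R) : Prop :=
  forall (x y : 'cV[R]_n) (t : R), x != y -> 0 < t < 1 ->
    g (t *: x + (1 - t) *: y) < t * g x + (1 - t) * g y.

Definition is_dir_deriv (n : nat) (g : 'cV[R]_n -> R) (x d : 'cV[R]_n) (D : R) : Prop :=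
  ((g (x + t *: d) - g x) / t) @[t --> 0^'+] --> D.

Definition Gmat (n N : nat) (f : 'I_N.+1 -> 'cV[R]_n -> R) (x : 'cV[R]_n) : 'M[R]_(N.+1, n) :=
  \matrix_(j, i) grad (f j) x i 0.
Definition fvec (n N : nat) (f : 'I_N.+1 -> 'cV[R]_n -> R) (x : 'cV[R]_n) : 'cV[R]_N.+1 :=
  \col_j f j x.

Definition in_simplex (m : nat) (lam : 'cV[R]_m) : Prop :=
  (forall i, 0 <= lam i 0) /\ \sum_(i < m) lam i 0 = 1.

Definition qp_obj (m n : nat) (G : 'M[R]_(m, n)) (fv lam : 'cV[R]_m) : R :=
  2^-1 * (lam^T *m G *m G^T *m lam) 0 0 - (fv^T *m lam) 0 0.

Definition qp_solution (m n : nat) (G : 'M[R]_(m, n)) (fv lam : 'cV[R]_m) : Prop :=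
  in_simplex lam /\ forall mu, in_simplex mu -> qp_obj G fv lam <= qp_obj G fv mu.

Definition algX_step (n N : nat) (f : 'I_N.+1 -> 'cV[R]_n -> R) (xk xk1 : 'cV[R]_n) : Prop :=
  let c : R := 2^-1 in let sigma : R := 2^-1 in
  exists lam : 'cV[R]_N.+1,
    qp_solution (Gmat f xk) (fvec f xk) lam /\
    let p := - ((Gmat f xk)^T *m lam) in
    let d := if p == 0 then 0 else (enorm p)^-1 *: p in
    if d == 0 then xk1 = xk + 1 *: d
    else exists D : R, is_dir_deriv (Phi f) xk d D /\
      let armijo (j : nat) :=
        Phi f (xk + sigma ^+ j *: d) < Phi f xk + c * sigma ^+ j * D in
      exists j : nat, armijo j /\ (forall i : nat, (i < j)%N -> ~ armijo i) /\
        xk1 = xk + sigma ^+ j *: d.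

End Defs.

(* Main.v *)
Require Import Defs.
From HB Require Import structures.
From mathcomp Require Import all_boot all_order all_algebra.
From mathcomp Require Import all_classical all_reals all_analysis.
From mathcomp Require Import ring lra.
Import Order.TTheory GRing.Theory Num.Theory.
Import numFieldNormedType.Exports.
Local Open Scope classical_set_scope.
Local Open Scope ring_scope.

(* Write [p = - G^T lam] for the (unnormalized) search direction.  Optimality of
   [lam] gives [f_j + grad f_j . p <= Phi - |p|^2] for all [j], so [p] is a descent
   direction, and [Phi x - min Phi] is bounded by a constant times [|p|] on the
   bounded level set containing the iterates.  If [Phi (x_k)] did not tend to the
   minimum, [|p_k|] would thus stay above some [eta > 0]; the Armijo decrease
   then makes the step lengths summable, [x_k] converges to some [xbar], and,
   [p] being uniformly continuous in [x], the unit directions [d_k] are Cauchy.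
   Hence, [K] being large and [T] the length of the path from [x_K] to [xbar],
   every [f_j] active at [xbar] satisfies [f_j (x_K) - Phi xbar = T (s_j + o(1))]
   with slopes [s_j >= eta - o(1)].  Let [i] be active at [x_K] and [j] at the
   last rejected trial point [x_K + 2 alpha d_K].  As [c = sigma = 1/2], the
   rejection reads [T s_i - alpha s_i <= T s_j - 2 alpha s_j + o(T)] and also
   implies [2 s_j <= s_i + o(1)]; with [alpha <= T] this forces [s_j <= o(1)],
   a contradiction.  So [Phi (x_k)] tends to the minimum, and strict convexity
   turns this into convergence of [x_k]. *)

(** * Inner product and Euclidean norm, and comparison with the sup norm *)

Section EuclideanSpace.
Context {R : realType} {n : nat}.
Implicit Types (u v y z : 'cV[R]_n) (a : R).

Definition dot u v : R := \sum_i u i 0 * v i 0.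

Lemma dotC u v : dot u v = dot v u.
Proof. by apply: eq_bigr => i _; rewrite mulrC. Qed.

Lemma dotDl u v y : dot (u + v) y = dot u y + dot v y.
Proof. by rewrite -big_split; apply: eq_bigr => i _; rewrite mxE mulrDl. Qed.

Lemma dotZl a u v : dot (a *: u) v = a * dot u v.
Proof. by rewrite mulr_sumr; apply: eq_bigr => i _; rewrite mxE mulrA. Qed.

Lemma dotNl u v : dot (- u) v = - dot u v.
Proof. by rewrite -scaleN1r dotZl mulN1r. Qed.

Lemma dot0l v : dot 0 v = 0.
Proof. by rewrite -(scale0r 0) dotZl mul0r. Qed.

Lemma dotBl u v y : dot (u - v) y = dot u y - dot v y.
Proof. by rewrite dotDl dotNl. Qed.

Lemma dotDr u v y : dot y (u + v) = dot y u + dot y v.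
Proof. by rewrite !(dotC y) dotDl. Qed.

Lemma dotZr a u v : dot u (a *: v) = a * dot u v.
Proof. by rewrite !(dotC u) dotZl. Qed.

Lemma dotNr u v : dot u (- v) = - dot u v.
Proof. by rewrite !(dotC u) dotNl. Qed.

Lemma dotBr u v y : dot y (u - v) = dot y u - dot y v.
Proof. by rewrite dotDr dotNr. Qed.

Lemma dot_suml (I : finType) (F : I -> 'cV[R]_n) v :
  dot (\sum_i F i) v = \sum_i dot (F i) v.
Proof.
by rewrite (big_morph (fun u => dot u v) (fun s t => dotDl s t v) (dot0l v)).
Qed.

Lemma dot_ge0 u : 0 <= dot u u.
Proof. by apply: sumr_ge0 => i _; rewrite -expr2 sqr_ge0. Qed.

Lemma enormE u : enorm u = Num.sqrt (dot u u).
Proof. by congr Num.sqrt; apply: eq_bigr => i _; rewrite expr2. Qed.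

Lemma enorm_ge0 u : 0 <= enorm u.
Proof. by rewrite enormE sqrtr_ge0. Qed.

Lemma sqr_enorm u : enorm u ^+ 2 = dot u u.
Proof. by rewrite enormE sqr_sqrtr // dot_ge0. Qed.

Lemma enorm_eq0 u : (enorm u == 0) = (u == 0).
Proof.
apply/idP/idP => [|/eqP->]; last by rewrite enormE dot0l sqrtr0.
rewrite -sqrf_eq0 sqr_enorm /dot psumr_eq0; last first.
  by move=> i _; rewrite -expr2 sqr_ge0.
move=> /allP u0; apply/eqP/matrixP => i j; rewrite ord1 mxE.
by have := u0 i (mem_index_enum _); rewrite -expr2 sqrf_eq0 => /eqP.
Qed.

Lemma enorm0 : enorm (0 : 'cV[R]_n) = 0.
Proof. by apply/eqP; rewrite enorm_eq0. Qed.

Lemma enormZ a u : enorm (a *: u) = `|a| * enorm u.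
Proof.
rewrite !enormE dotZl dotZr mulrA -expr2 sqrtrM ?sqr_ge0 //.
by rewrite sqrtr_sqr.
Qed.

Lemma enormN u : enorm (- u) = enorm u.
Proof. by rewrite -scaleN1r enormZ normrN1 mul1r. Qed.

Lemma enormC u v : enorm (u - v) = enorm (v - u).
Proof. by rewrite -enormN opprB. Qed.

(** Cauchy-Schwarz: expanding the square of [enorm v *: u - enorm u *: v] gives twice
    [enorm u * enorm v] times the difference of the two sides. *)
Lemma dot_le u v : dot u v <= enorm u * enorm v.
Proof.
have [->|u0] := eqVneq u 0; first by rewrite dot0l enorm0 mul0r.
have [->|v0] := eqVneq v 0; first by rewrite dotC dot0l enorm0 mulr0.
have Eu : 0 < enorm u by rewrite lt_neqAle eq_sym enorm_eq0 u0 enorm_ge0.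
have Ev : 0 < enorm v by rewrite lt_neqAle eq_sym enorm_eq0 v0 enorm_ge0.
have := dot_ge0 (enorm v *: u - enorm u *: v).
rewrite dotBl !dotBr !dotZl !dotZr -!sqr_enorm (dotC v u).
set a := enorm u in Eu *; set b := enorm v in Ev *; set c := dot u v.
move=> h; rewrite -subr_ge0 -(@pmulr_lge0 _ (2 * (a * b))) ?mulr_gt0 //.
apply: le_trans h _; rewrite le_eqVlt; apply/orP; left; apply/eqP; ring.
Qed.

Lemma normr_dot_le u v : `|dot u v| <= enorm u * enorm v.
Proof.
by rewrite ler_norml dot_le andbT lerNl -dotNl (le_trans (dot_le _ _)) ?enormN.
Qed.

Lemma ler_enormD u v : enorm (u + v) <= enorm u + enorm v.
Proof.
rewrite -(@ler_pXn2r _ 2) ?nnegrE ?addr_ge0 ?enorm_ge0 //.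
rewrite sqr_enorm dotDl !dotDr (dotC v u) sqrrD -!sqr_enorm.
have := dot_le u v; lra.
Qed.

Lemma ler_enorm_dist y u v : enorm (u - v) <= enorm (u - y) + enorm (y - v).
Proof. by rewrite (le_trans _ (ler_enormD _ _)) // addrA subrK. Qed.

Lemma ler_dist_enorm u v : `|enorm u - enorm v| <= enorm (u - v).
Proof.
rewrite ler_norml; have := ler_enorm_dist u v 0; have := ler_enorm_dist v u 0.
by rewrite !subr0 (enormC v u); lra.
Qed.

Lemma enorm_sum_le (I : finType) (c : I -> R) (F : I -> 'cV[R]_n) a :
  (forall i, 0 <= c i) -> \sum_i c i = 1 -> (forall i, enorm (F i) <= a) ->
  enorm (\sum_i c i *: F i) <= a.
Proof.
move=> c0 c1 Fa; apply: (@le_trans _ _ (\sum_i c i * enorm (F i))).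
  elim/big_ind2 : _ => [|u s v t us vt|i _]; first by rewrite enorm0.
    by rewrite (le_trans (ler_enormD _ _)) // lerD.
  by rewrite enormZ ger0_norm.
rewrite -[leRHS]mul1r -c1 mulr_suml; apply: ler_sum => i _.
exact: ler_wpM2l.
Qed.

Lemma enorm_normalize u : u != 0 -> enorm ((enorm u)^-1 *: u) = 1.
Proof.
move=> u0; rewrite enormZ ger0_norm ?invr_ge0 ?enorm_ge0 // mulVf //.
by rewrite enorm_eq0.
Qed.

(** The difference of the unit vectors splits into [u - v] and a multiple of a unit vector by
    [enorm v - enorm u], both over [enorm u]; each part costs at most [enorm (u - v)]. *)
Lemma enorm_normalize_dist u v : u != 0 -> v != 0 ->
  enorm ((enorm u)^-1 *: u - (enorm v)^-1 *: v) <= 2 * enorm (u - v) / enorm u.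
Proof.
move=> u0 v0.
have Eu : 0 < enorm u by rewrite lt_neqAle eq_sym enorm_eq0 u0 enorm_ge0.
have Ev : 0 < enorm v by rewrite lt_neqAle eq_sym enorm_eq0 v0 enorm_ge0.
have -> : (enorm u)^-1 *: u - (enorm v)^-1 *: v =
    (enorm u)^-1 *: ((u - v) + (enorm v - enorm u) *: ((enorm v)^-1 *: v)).
  by apply/matrixP => i j; rewrite !mxE; field; rewrite !gt_eqF.
rewrite enormZ ger0_norm ?invr_ge0 ?enorm_ge0 // mulrC ler_pM2r ?invr_gt0 //.
rewrite (le_trans (ler_enormD _ _)) // mulr_natl mulr2n lerD2l.
rewrite enormZ enorm_normalize // mulr1 distrC.
exact: ler_dist_enorm.
Qed.

Lemma ler_coord_norm u i : `|u i 0| <= `|u|.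
Proof.
rewrite [leRHS]/Num.Def.normr /= mx_normrE.
by apply/bigmax_geP; right => /=; exists (i, 0).
Qed.

Lemma norm_le_enorm u : `|u| <= enorm u.
Proof.
rewrite [leLHS]/Num.Def.normr /= mx_normrE; apply: bigmax_le; first exact: enorm_ge0.
move=> [i j] _; rewrite /= ord1 /enorm -sqrtr_sqr ler_wsqrtr //.
rewrite (bigD1 i) //= lerDl; apply: sumr_ge0 => k _; exact: sqr_ge0.
Qed.

Lemma enorm_le_norm u : enorm u <= n%:R * `|u|.
Proof.
have nu : 0 <= n%:R * `|u| by rewrite mulr_ge0.
rewrite -(@ler_pXn2r _ 2) ?nnegrE ?enorm_ge0 // sqr_enorm.
apply: (@le_trans _ _ (\sum_(i < n) `|u| ^+ 2)).
  apply: ler_sum => i _; rewrite -expr2 -real_normK ?num_real //.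
  by rewrite ler_pXn2r ?nnegrE // ler_coord_norm.
rewrite sumr_const card_ord -[leLHS]mulr_natl exprMn ler_wpM2r ?sqr_ge0 //.
by rewrite -natrX ler_nat expnS expn1; case: (n) => // k; rewrite leq_pmulr.
Qed.

End EuclideanSpace.

(** * Gradients, directional derivatives and tangent inequalities *)

Section ConvexFunctions.
Context {R : realType} {n : nat}.
Implicit Types (g : 'cV[R]_n -> R) (x y d : 'cV[R]_n).

Lemma diff_dot_grad g x d : 'd g x d = dot (grad g x) d.
Proof.
rewrite [in LHS](matrix_sum_delta d) linear_sum.
by apply: eq_bigr => i _; rewrite big_ord1 linearZ mxE mulrC.
Qed.

Lemma is_dir_deriv_grad g x d :
  differentiable g x -> is_dir_deriv g x d (dot (grad g x) d).
Proof.
move=> dg; rewrite -diff_dot_grad -deriveE //.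
apply: cvg_dnbhs_at_right.
have /cvg_ex[l gl] := @diff_derivable _ _ _ _ _ d dg.
have -> : 'D_d g x = l by apply: cvg_lim.
rewrite (_ : (fun t => _) = (fun h => h^-1 *: ((g \o shift x) (h *: d) - g x))) //.
by apply/funext => h /=; rewrite mulrC (addrC x).
Qed.

(** By convexity the difference quotients from [x] towards [y] stay below [g y - g x]; the slope is
    their limit. *)
Lemma convex_ge_tangent g x y : strictly_convex g -> differentiable g x ->
  g x + dot (grad g x) (y - x) <= g y.
Proof.
move=> cg dg; have [->|xy] := eqVneq x y; first by rewrite subrr dotC dot0l addr0.
rewrite addrC -lerBrDr.
apply: (cvgr_to_le (is_dir_deriv_grad g x (y - x) dg)).
near=> t.
have t0 : 0 < t by near: t; exact: nbhs_right_gt.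
have t1 : t < 1 by near: t; apply: nbhs_right_lt.
have := cg y x t; rewrite eq_sym xy t0 t1 => /(_ isT isT) h.
rewrite ler_pdivrMr //.
have -> : x + t *: (y - x) = t *: y + (1 - t) *: x.
  by apply/matrixP => i j; rewrite !mxE; ring.
lra.
Unshelve. all: by end_near. Qed.

Lemma dir_deriv_mono g h x d D D' : g x = h x -> (forall y, g y <= h y) ->
  is_dir_deriv g x d D -> is_dir_deriv h x d D' -> D <= D'.
Proof.
move=> ghx gh gD hD'; apply: (ler_cvg_to gD hD').
near=> t.
have t0 : 0 < t by near: t; exact: nbhs_right_gt.
by rewrite ler_pM2r ?invr_gt0 // ghx lerD2r.
Unshelve. all: by end_near. Qed.

End ConvexFunctions.

(** * The pointwise maximum *)

Section MaxFunction.
Context {R : realType} {n N : nat} (f : 'I_N.+1 -> 'cV[R]_n -> R).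

Lemma Phi_ge j y : f j y <= Phi f y.
Proof. exact: le_bigmax. Qed.

Lemma Phi_le y a : (forall j, f j y <= a) -> Phi f y <= a.
Proof. by move=> h; apply: bigmax_le. Qed.

Lemma Phi_attained y : exists j, Phi f y = f j y.
Proof.
have /bigmax_geP[h|[j _ h]] : Phi f y <= Phi f y by [].
  by exists ord0; apply/eqP; rewrite eq_le h Phi_ge.
by exists j; apply/eqP; rewrite eq_le h Phi_ge.
Qed.

End MaxFunction.

(** * First-order optimality in the quadratic program *)

Section QuadraticProgram.
Context {R : realType} {m n : nat} (G : 'M[R]_(m, n)) (fv : 'cV[R]_m).

Lemma qp_objE lam :
  qp_obj G fv lam = 2^-1 * dot (G^T *m lam) (G^T *m lam) - dot fv lam.
Proof.
have dotE k (u v : 'cV[R]_k) : (u^T *m v) 0 0 = dot u v.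
  by rewrite mxE; apply: eq_bigr => i _; rewrite mxE.
by rewrite /qp_obj -!dotE trmx_mul trmxK !mulmxA.
Qed.

(** Moving from [lam] towards [mu] stays in the simplex, so the derivative of the objective at [lam]
    in that direction cannot be negative. *)
Lemma qp_variation lam mu : qp_solution G fv lam -> in_simplex mu ->
  dot fv (mu - lam) <= dot (G^T *m lam) (G^T *m (mu - lam)).
Proof.
move=> [[lam0 lam1] hmin] [mu0 mu1].
set v := mu - lam; set u := G^T *m lam; set z := G^T *m v.
rewrite leNgt; apply/negP => h.
have q (t : R) : 0 <= t <= 1 -> 0 <= t * (dot u z - dot fv v) + t ^+ 2 * (2^-1 * dot z z).
  move=> /andP[t0 t1].
  have st : in_simplex (lam + t *: v).
    split=> [i|].
      have -> : (lam + t *: v) i 0 = (1 - t) * lam i 0 + t * mu i 0.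
        by rewrite !mxE; ring.
      by rewrite addr_ge0 // mulr_ge0 // subr_ge0.
    under eq_bigr do rewrite !mxE.
    by rewrite big_split /= -mulr_sumr sumrB mu1 lam1 subrr mulr0 addr0.
  have H := hmin _ st; rewrite !qp_objE mulmxDr -scalemxAr -/u -/z in H.
  rewrite dotDl !dotDr !(dotZl, dotZr) (dotC z u) in H; lra.
have zz := dot_ge0 z.
have a0 : dot u z - dot fv v < 0 by rewrite subr_lt0.
set a := dot u z - dot fv v in a0 q; set b := dot z z in zz q.
have D0 : 0 < b - a by lra.
(* Dividing by [b - a] rather than [b] allows [b = 0], keeps [t <= 1], and gives [t * b <= - a], so
   that [a + t * b / 2 <= a / 2 < 0]. *)
pose t := - a / (b - a).
have t0 : 0 < t by rewrite divr_gt0 //; lra.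
have t1 : t <= 1 by rewrite ler_pdivrMr //; lra.
have := q t; rewrite (ltW t0) t1 => /(_ isT).
have -> : t * a + t ^+ 2 * (2^-1 * b) = t * (a + t * (2^-1 * b)) by ring.
rewrite pmulr_rge0 //.
have tb : t * b <= - a.
  rewrite /t mulrAC ler_pdivrMr // ler_pM2l; lra.
lra.
Qed.

End QuadraticProgram.

(** * The search direction: descent, optimality gap, stability, one step *)

Section SearchDirection.
Context {R : realType} {n N : nat} (f : 'I_N.+1 -> 'cV[R]_n -> R).
Implicit Types (x y u v d : 'cV[R]_n) (lam mu : 'cV[R]_N.+1).

(** The unnormalized [p_k] of Algorithm X, defined for any multiplier so that optimality can be
    tested against competitors. *)
Definition search_dir x lam : 'cV[R]_n := - ((Gmat f x)^T *m lam).

Lemma search_dirE x lam :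
  search_dir x lam = - \sum_j lam j 0 *: grad (f j) x.
Proof.
congr (- _); apply/matrixP => i k; rewrite ord1 mxE summxE.
by apply: eq_bigr => j _; rewrite !mxE mulrC.
Qed.

Lemma dot_fvec x lam : dot (fvec f x) lam = \sum_j lam j 0 * f j x.
Proof. by apply: eq_bigr => j _; rewrite mxE mulrC. Qed.

Lemma dot_fvec_le x lam : in_simplex lam -> dot (fvec f x) lam <= Phi f x.
Proof.
move=> [lam0 lam1]; rewrite dot_fvec -[leRHS]mul1r -lam1 mulr_suml.
by apply: ler_sum => j _; rewrite ler_wpM2l // Phi_ge.
Qed.

Lemma search_dir_variation x lam mu :
  qp_solution (Gmat f x) (fvec f x) lam -> in_simplex mu ->
  dot (fvec f x) mu - dot (search_dir x lam) (search_dir x mu) <=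
  dot (fvec f x) lam - enorm (search_dir x lam) ^+ 2.
Proof.
move=> qlam smu; have := qp_variation _ _ _ _ qlam smu.
rewrite sqr_enorm /search_dir !dotNl !dotNr !opprK mulmxBr !dotBr; lra.
Qed.

Lemma search_dir_fold x lam : - ((Gmat f x)^T *m lam) = search_dir x lam.
Proof. by []. Qed.

(** The variational inequality tested at the [j]-th vertex of the simplex. *)
Lemma search_dir_slope x lam j : qp_solution (Gmat f x) (fvec f x) lam ->
  f j x + dot (grad (f j) x) (search_dir x lam) <=
  dot (fvec f x) lam - enorm (search_dir x lam) ^+ 2.
Proof.
move=> qlam; have E i : (delta_mx j 0 : 'cV[R]_N.+1) i 0 = (i == j)%:R.
  by rewrite mxE eqxx andbT.
have sj : in_simplex (delta_mx j 0 : 'cV[R]_N.+1).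
  split=> [i|]; first by rewrite E.
  rewrite (bigD1 j) //= E eqxx big1 ?addr0 // => i /negPf ij.
  by rewrite E ij.
have := search_dir_variation _ _ _ qlam sj.
rewrite (dot_fvec x (delta_mx j 0)) (search_dirE x (delta_mx j 0)).
rewrite (bigD1 j) //= E eqxx mul1r big1 ?addr0; last first.
  by move=> i /negPf ij; rewrite E ij mul0r.
rewrite (bigD1 j) //= E eqxx scale1r big1 ?addr0; last first.
  by move=> i /negPf ij; rewrite E ij scale0r.
by rewrite dotNr opprK dotC.
Qed.

Hypothesis diff_f : forall j y, differentiable (f j) y.
Hypothesis cvx_f : forall j, strictly_convex (f j).

(** Averaging the tangent inequalities with weights [lam] bounds [Phi f y] below ([h1]); the slope
    inequality shows that the average of the [f j x] misses [Phi f x] by at most [L * enorm p]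
    ([h2]). *)
Lemma Phi_gap x y lam L : qp_solution (Gmat f x) (fvec f x) lam ->
  (forall j, enorm (grad (f j) x) <= L) ->
  Phi f x - Phi f y <= enorm (search_dir x lam) * (L + enorm (y - x)).
Proof.
move=> qlam gL; set p := search_dir x lam.
have [lam0 lam1] := qlam.1.
have h1 : dot (fvec f x) lam - dot p (y - x) <= Phi f y.
  apply: le_trans (dot_fvec_le y lam qlam.1).
  rewrite /p search_dirE dotNl opprK dot_suml !dot_fvec -big_split /=.
  apply: ler_sum => j _; rewrite dotZl -mulrDr ler_wpM2l //.
  exact: convex_ge_tangent.
have h2 : Phi f x <= dot (fvec f x) lam + L * enorm p.
  apply: Phi_le => j; have := search_dir_slope x lam j qlam; rewrite -/p.
  have := normr_dot_le (grad (f j) x) p; rewrite ler_norml => /andP[h _].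
  have : enorm (grad (f j) x) * enorm p <= L * enorm p.
    by rewrite ler_wpM2r ?enorm_ge0.
  have := sqr_ge0 (enorm p); lra.
have := dot_le p (y - x); rewrite mulrDr (mulrC _ L); lra.
Qed.

(** Each of the two variational inequalities is tested at the other problem's multiplier and the
    results are added; swapping [x] and [y] under a fixed multiplier costs [a] in direction and [b]
    in value. *)
Lemma search_dir_stable x y lam mu (a b : R) :
  qp_solution (Gmat f x) (fvec f x) lam ->
  qp_solution (Gmat f y) (fvec f y) mu ->
  (forall j, enorm (grad (f j) x - grad (f j) y) <= a) ->
  (forall j, `|f j x - f j y| <= b) ->
  enorm (search_dir x lam - search_dir y mu) ^+ 2 <=
  a * (enorm (search_dir x lam) + enorm (search_dir y mu)) + 2 * b.
Proof.
move=> qlam qmu ga fb.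
set p := search_dir x lam; set q := search_dir y mu.
have [lam0 lam1] := qlam.1; have [mu0 mu1] := qmu.1.
have h1 : dot (fvec f x) mu - dot p (search_dir x mu) <=
    dot (fvec f x) lam - enorm p ^+ 2 by exact: search_dir_variation.
have h2 : dot (fvec f y) lam - dot q (search_dir y lam) <=
    dot (fvec f y) mu - enorm q ^+ 2 by exact: search_dir_variation.
have dist kap : in_simplex kap ->
    enorm (search_dir x kap - search_dir y kap) <= a.
  move=> [k0 k1]; rewrite !search_dirE opprK addrC -sumrB.
  under eq_bigr do rewrite -scalerBr.
  have h := enorm_sum_le _ (fun j => kap j 0) (fun j => grad (f j) y - grad (f j) x) a.
  by apply: (h k0 k1) => j; rewrite enormC.
have e1 : - dot p (search_dir x mu - q) >= - (a * enorm p).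
  rewrite lerN2 (le_trans (dot_le _ _)) // mulrC ler_wpM2r ?enorm_ge0 //.
  exact: dist qmu.1.
have e2 : - dot q (search_dir y lam - p) >= - (a * enorm q).
  rewrite lerN2 (le_trans (dot_le _ _)) // mulrC ler_wpM2r ?enorm_ge0 //.
  by rewrite enormC; exact: dist qlam.1.
have e3 kap : in_simplex kap ->
    `|dot (fvec f x) kap - dot (fvec f y) kap| <= b.
  move=> [k0 k1]; rewrite !dot_fvec -sumrB -[leRHS]mul1r -k1 mulr_suml.
  rewrite (le_trans (ler_norm_sum _ _ _)) // ler_sum // => j _.
  by rewrite -mulrBr normrM ger0_norm // ler_wpM2l.
have := e3 _ qlam.1; have := e3 _ qmu.1; rewrite !ler_norml.
move=> /andP[b1 b2] /andP[b3 b4].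
rewrite sqr_enorm dotBl !dotBr (dotC q p) -!sqr_enorm.
clearbody p q; move: (search_dir x mu) (search_dir y lam) h1 h2 e1 e2 => s t.
rewrite !dotBr (dotC q p).
move: (dot _ mu) (dot _ lam) (dot _ mu) (dot _ lam) b1 b2 b3 b4 => ? ? ? ?.
lra.
Qed.

Variable w : R -> R.
Hypothesis mod_w : modulus w.
Hypothesis grad_w : forall j y z,
  enorm (grad (f j) y - grad (f j) z) <= w (enorm (y - z)).

(** The tangent at [y], evaluated at [x], bounds [f j y] above; moving its gradient to [x] costs the
    modulus term. *)
Lemma convex_le_tangent j x y :
  f j y <= f j x + dot (grad (f j) x) (y - x) + enorm (y - x) * w (enorm (y - x)).
Proof.
have := convex_ge_tangent (f j) y x (cvx_f j) (diff_f j y).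
have := dot_le (grad (f j) y - grad (f j) x) (y - x).
have : enorm (grad (f j) y - grad (f j) x) * enorm (y - x) <=
    enorm (y - x) * w (enorm (y - x)).
  by rewrite mulrC ler_wpM2l ?enorm_ge0.
move: (grad (f j) x) (grad (f j) y) => gx gy.
rewrite -(opprB y x) dotNr dotBl; lra.
Qed.

Lemma dir_deriv_search_dir x lam D : qp_solution (Gmat f x) (fvec f x) lam ->
  let p := search_dir x lam in p != 0 ->
  is_dir_deriv (Phi f) x ((enorm p)^-1 *: p) D -> D <= - enorm p.
Proof.
move=> qlam p p0 hD; set d := (enorm p)^-1 *: p in hD.
have Ep : 0 < enorm p by rewrite lt_neqAle eq_sym enorm_eq0 p0 enorm_ge0.
have pE : p = enorm p *: d by rewrite scalerA mulfV ?scale1r // gt_eqF.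
have d1 : enorm d = 1 by apply: enorm_normalize.
have w0 : - enorm p + w t @[t --> 0^'+] --> - enorm p.
  rewrite -[X in _ --> X]addr0; apply: cvgD; first exact: cvg_cst.
  exact: mod_w.2.2.
apply: (ler_cvg_to hD w0); near=> t.
have t0 : 0 < t by near: t; exact: nbhs_right_gt.
have tp : t < enorm p by near: t; apply: nbhs_right_lt.
rewrite ler_pdivrMr // lerBlDr; apply: Phi_le => j.
have := convex_le_tangent j x (x + t *: d).
rewrite [x + _]addrC addrK enormZ d1 mulr1 gtr0_norm // dotZr.
have := search_dir_slope x lam j qlam; rewrite -/p [in dot _ p]pE dotZr.
have := dot_fvec_le x lam qlam.1; have := Phi_ge f j x.
set s := dot _ d; set q := enorm p; set F := dot _ lam.
have q0 : 0 < q := Ep; have tq : t < q := tp.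
move=> h1 h2 h3.
(* The left side is the convex combination, with weights [1 - t / q] and [t / q], of
   [f j x <= Phi f x] and [f j x + q * s <= Phi f x - q ^+ 2]; everything is multiplied by [q]. *)
suff : f j x + t * s <= Phi f x - t * q by lra.
rewrite -(ler_pM2l q0).
have : (q - t) * f j x <= (q - t) * Phi f x by rewrite ler_wpM2l // subr_ge0 ltW.
have : t * (f j x + q * s) <= t * (Phi f x - q ^+ 2).
  by apply: ler_wpM2l; [exact: ltW|lra].
lra.
Unshelve. all: by end_near. Qed.

Lemma algX_stepP u v : algX_step f u v -> exists lam,
  let p := search_dir u lam in let d := (enorm p)^-1 *: p in
  [/\ qp_solution (Gmat f u) (fvec f u) lam, p = 0 -> v = u &
   p != 0 -> exists a, [/\ 0 < a, v = u + a *: d,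
     Phi f v <= Phi f u - 2^-1 * a * enorm p &
     a < 1 -> forall i, f i u = Phi f u ->
       Phi f u + a * dot (grad (f i) u) d <= Phi f (u + (2 * a) *: d)]].
Proof.
move=> [lam [qlam]] /=; rewrite search_dir_fold => h.
exists lam; split=> // [p0|p0].
  by move: h; rewrite p0 !eqxx => ->; rewrite scaler0 addr0.
move: h; rewrite (negPf p0); set p := search_dir u lam in p0 *.
set d := (enorm p)^-1 *: p.
have d1 : enorm d = 1 by apply: enorm_normalize.
have -> : (d == 0) = false by rewrite -enorm_eq0 d1 oner_eq0.
move=> [D [hD [j [arm [narm ->]]]]]; have Dp := dir_deriv_search_dir u lam D qlam p0 hD.
have a0 : 0 < (2^-1 : R) ^+ j by rewrite exprn_gt0 // invr_gt0.
exists (2^-1 ^+ j); split=> //.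
  have : 2^-1 ^+ j * D <= 2^-1 ^+ j * - enorm p by rewrite ler_pM2l.
  by rewrite -/p; lra.
(* A step below 1 has a positive exponent, so the previous exponent, giving twice the step, was
   rejected; [c = 1/2] cancels the doubling. *)
case: j arm narm a0 => [|j] arm narm a0; first by rewrite expr0 ltxx.
move=> _ i fi; have := narm j (ltnSn j).
have -> : 2 * 2^-1 ^+ j.+1 = 2^-1 ^+ j :> R by rewrite exprS mulrA mulfV ?mul1r.
move/negP; rewrite -leNgt; apply: le_trans.
have Di : dot (grad (f i) u) d <= D.
  exact: dir_deriv_mono fi (Phi_ge f i) (is_dir_deriv_grad _ _ _ (diff_f i u)) hD.
by rewrite -exprS lerD2l ler_pM2l.
Qed.

End SearchDirection.

(** * Linear growth of a strictly convex function away from its minimum *)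

Section Growth.
Context {R : realType} {n : nat}.

Lemma norm_trmx (v : 'rV[R]_n) : `|v^T| = `|v|.
Proof.
rewrite /Num.Def.normr /= !mx_normrE; apply/eqP; rewrite eq_le.
apply/andP; split; apply: bigmax_le; rewrite ?bigmax_ge_id //.
- move=> [i j] _; rewrite mxE.
  exact: (@le_bigmax _ _ _ _ (fun ij => `|v ij.1 ij.2|) (j, i)).
- move=> [i j] _; have := @le_bigmax _ R _ 0 (fun ij => `|v^T ij.1 ij.2|) (j, i).
  by rewrite mxE.
Qed.

Lemma continuous_trmx : continuous (fun v : 'rV[R]_n => v^T).
Proof.
move=> v; apply/(@cvgrPdist_le _ _ _ (nbhs v)) => e e0; near=> u.
rewrite -linearB norm_trmx; near: u.
exact: (@cvgr_dist_le _ _ _ (nbhs v) _ id v).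
Unshelve. all: by end_near. Qed.

Variables (g : 'cV[R]_n -> R) (z : 'cV[R]_n).
Hypothesis cont_g : continuous g.
Hypothesis cvx_g : strictly_convex g.
Hypothesis min_g : forall y, g z <= g y.

Lemma strict_min y : y != z -> g z < g y.
Proof.
move=> yz; have h : 0 < (2^-1 : R) < 1 by lra.
have := cvx_g y z 2^-1 yz h; have := min_g (2^-1 *: y + (1 - 2^-1) *: z); lra.
Qed.

(** By compactness the excess over [g z] has a positive minimum on the sphere of radius [r];
    convexity along rays from [z] propagates it linearly. Row vectors carry the compactness
    argument. *)
Lemma strictly_convex_growth r : 0 < r ->
  exists2 m, 0 < m & forall y, r <= `|y - z| -> m * `|y - z| <= g y - g z.
Proof.
move=> r0; pose S := [set v : 'rV[R]_n | `|v| = r].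
have scale y : r <= `|y - z| -> S ((r / `|y - z|) *: (y - z))^T.
  move=> ry; rewrite /S /= -norm_trmx trmxK normrZ gtr0_norm; last first.
    by rewrite divr_gt0 // (lt_le_trans r0).
  by rewrite divfK // gt_eqF // (lt_le_trans r0).
(* If the sphere is empty (dimension 0), no [y] lies at distance [r] or more, and any [m] serves. *)
have [[v Sv]|S0] := pselect (S !=set0); last first.
  by exists 1 => // y /scale Sy; exfalso; apply: S0; eexists; exact: Sy.
have cS : compact S.
  apply: bounded_closed_compact.
    exists r; split; first exact: num_real.
    by move=> a ra u /= ->; exact: ltW.
  apply: (@closed_comp _ _ (fun u : 'rV[R]_n => `|u|) [set r]).
    by move=> u _; exact: norm_continuous.
  exact: closed_eq.
have [c /set_mem Sc hc] : exists2 c, c \in S &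
    forall u, u \in S -> g (z + c^T) <= g (z + u^T).
  apply: (@compact_EVT_min _ _ (fun u : 'rV[R]_n => g (z + u^T)) S) => //.
    by exists v.
  apply: continuous_subspaceT => u.
  apply: (@continuous_comp _ _ _ (fun u : 'rV[R]_n => z + u^T) g).
    by apply: continuousD; [exact: cst_continuous|exact: continuous_trmx].
  exact: cont_g.
have mc : g z < g (z + c^T).
  apply: strict_min; rewrite -subr_eq0 addrC addKr -normr_eq0 norm_trmx Sc.
  by rewrite gt_eqF.
exists ((g (z + c^T) - g z) / r); first by rewrite divr_gt0 // subr_gt0.
move=> y ry; have := hc _ (mem_set (scale y ry)); rewrite trmxK.
set q := `|y - z| in ry *; have q0 : 0 < q by rewrite (lt_le_trans r0).
move=> le1.
have le2 : g (z + (r / q) *: (y - z)) <= (r / q) * g y + (1 - r / q) * g z.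
  have [<-|neq] := eqVneq r q.
    by rewrite divff ?gt_eqF // subrr mul0r addr0 mul1r scale1r addrC subrK.
  have yz : y != z by rewrite -subr_eq0 -normr_eq0 gt_eqF.
  have rq : 0 < r / q < 1.
    by rewrite divr_gt0 //= ltr_pdivrMr // mul1r lt_neqAle neq.
  have := cvx_g y z _ yz rq.
  have -> : (r / q) *: y + (1 - r / q) *: z = z + (r / q) *: (y - z).
    by apply/matrixP => i j; rewrite !mxE; ring.
  exact: ltW.
rewrite mulrAC ler_pdivrMr // -[leRHS]mulrC -ler_pdivlMr // mulrAC; lra.
Qed.

End Growth.

(** * Monotone limits, moduli and convergence of vector sequences *)

Section Limits.
Context {R : realType}.

Lemma cvg_nondecreasing_ge (u : nat -> R) l K :
  (forall k, (K <= k)%N -> u k <= u k.+1) -> u @ \oo --> l -> u K <= l.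
Proof.
move=> hu ul; apply: (cvgr_to_ge ul); exists K => // k /= Kk.
elim: k Kk => [|k IH]; first by rewrite leqn0 => /eqP->.
by rewrite leq_eqVlt => /predU1P[->//|Kk]; rewrite (le_trans (IH Kk)) // hu.
Qed.

Lemma cvg_nonincreasing_le (u : nat -> R) l K :
  (forall k, (K <= k)%N -> u k.+1 <= u k) -> u @ \oo --> l -> l <= u K.
Proof.
move=> hu ul; rewrite -lerN2; apply: (@cvg_nondecreasing_ge (fun k => - u k)).
  by move=> k Kk; rewrite lerN2 hu.
exact: cvgN.
Qed.

Lemma modulus_small (w : R -> R) e : modulus w -> 0 < e ->
  exists2 r, 0 < r & forall t, 0 <= t <= r -> w t <= e.
Proof.
move=> [wmon [w0 wcvg]] e0.
have /= := cvgr_le _ wcvg e e0; rewrite near_withinE /= => -[r /= r0 hr].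
exists (r / 2); first by rewrite divr_gt0.
(* The right-hand limit says nothing at 0, where [w 0 = 0] is used instead. *)
move=> t /andP[t0 tr]; have [->|tn0] := eqVneq t 0; first by rewrite w0 ltW.
apply: hr; last by rewrite lt_neqAle eq_sym tn0.
by rewrite /= sub0r normrN ger0_norm //; lra.
Qed.

Lemma enorm_cvgP {n : nat} (x : nat -> 'cV[R]_n) (l : 'cV[R]_n) (T : nat -> R) :
  (forall k, enorm (x k - l) <= T k) -> T @ \oo --> 0 -> x @ \oo --> l.
Proof.
move=> xT T0; apply/cvgrPdist_le => e e0; near=> k.
rewrite distrC (le_trans (norm_le_enorm _)) // (le_trans (xT k)) //.
by near: k; exact: cvgr_le T0 _ e0.
Unshelve. all: by end_near. Qed.

Lemma cvg_enorm_sub {n : nat} (x : nat -> 'cV[R]_n) (l : 'cV[R]_n) :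
  x @ \oo --> l -> enorm (x k - l) @[k --> \oo] --> 0.
Proof.
move=> xl.
have h : n%:R * `|x k - l| @[k --> \oo] --> 0.
  rewrite -[X in _ --> X](mulr0 n%:R); apply: cvgM; first exact: cvg_cst.
  rewrite -(@normr0 _ 'cV[R]_n) -(subrr l); apply: cvg_norm.
  by apply: cvgB => //; exact: cvg_cst.
apply: (@squeeze_cvgr _ _ _ _ (fun=> 0)) h; last exact: cvg_cst.
by near=> k; rewrite enorm_ge0 enorm_le_norm.
Unshelve. all: by end_near. Qed.

Lemma enorm_cauchy_cvg {n : nat} (x : nat -> 'cV[R]_n) (s : nat -> R) (l : R) :
  (forall k m, (k <= m)%N -> enorm (x m - x k) <= s m - s k) ->
  s @ \oo --> l -> cvgn x.
Proof.
move=> xs sl; apply: cauchy_cvg; apply: cauchy_exP => e e0.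
move/cvgrPdist_lt : sl => /(_ _ (divr_gt0 e0 (@ltr0Sn R 1)))[K _ hK].
exists (x K), K => // k /= Kk; rewrite -ball_normE /= distrC.
rewrite (le_lt_trans (norm_le_enorm _)) // (le_lt_trans (xs _ _ Kk)) //.
have := hK _ Kk; have := hK _ (leqnn K); rewrite /= !ltr_norml; lra.
Qed.

End Limits.

(** * Continuity and strict convexity of the maximum *)

Section PhiRegularity.
Context {R : realType} {n N : nat} (f : 'I_N.+1 -> 'cV[R]_n -> R).

Lemma continuous_Phi : (forall j, continuous (f j)) -> continuous (Phi f).
Proof.
move=> cf; rewrite /Phi; move: (index_enum _) => s y.
elim: s => [|j s IH].
  have -> : (fun z => \big[Num.max/f ord0 z]_(j <- [::]) f j z) = f ord0.
    by apply/funext => z; rewrite big_nil.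
  exact: cf.
have -> : (fun z => \big[Num.max/f ord0 z]_(j <- j :: s) f j z) =
    (f j \max (fun z => \big[Num.max/f ord0 z]_(j <- s) f j z)).
  by apply/funext => z; rewrite big_cons.
by apply: continuous_max => //; exact: cf.
Qed.

Lemma strictly_convex_Phi :
  (forall j, strictly_convex (f j)) -> strictly_convex (Phi f).
Proof.
move=> cf y z t yz t01; have [j ->] := Phi_attained f (t *: y + (1 - t) *: z).
apply: (lt_le_trans (cf j y z t yz t01)); move: t01 => /andP[t0 t1].
by rewrite lerD // ler_wpM2l ?Phi_ge //; lra.
Qed.

End PhiRegularity.

(** * Search directions bounded away from zero lead to a contradiction *)

(* The gradients and search directions enter only through the inequalities they
   satisfy: left concrete, unification would unfold them down to differentials. *)
Section Jamming.
Context {R : realType} {n N : nat}.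
Variables (f : 'I_N.+1 -> 'cV[R]_n -> R) (g : 'I_N.+1 -> 'cV[R]_n -> 'cV[R]_n).
Variables (w : R -> R) (M L eta : R).
Variables (x p d : nat -> 'cV[R]_n) (alpha : nat -> R).
Hypothesis cont_f : forall j, continuous (f j).
Hypothesis f_ge : forall j y, M <= f j y.
Hypothesis tangent : forall j (y z : 'cV[R]_n), f j y + dot (g j y) (z - y) <= f j z.
Hypothesis mod_w : modulus w.
Hypothesis g_w : forall j y z, enorm (g j y - g j z) <= w (enorm (y - z)).
Hypothesis eta_gt0 : 0 < eta.
Hypothesis p_ge : forall k, eta <= enorm (p k).
Hypothesis p_le : forall k, enorm (p k) <= L.
Hypothesis g_le : forall j k, enorm (g j (x k)) <= L.
Hypothesis p_slope : forall j k,
  f j (x k) + dot (g j (x k)) (p k) <= Phi f (x k) - enorm (p k) ^+ 2.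
Hypothesis p_stable : forall k m (a b : R),
  (forall j, enorm (g j (x k) - g j (x m)) <= a) ->
  (forall j, `|f j (x k) - f j (x m)| <= b) ->
  enorm (p k - p m) ^+ 2 <= a * (enorm (p k) + enorm (p m)) + 2 * b.
Hypothesis dE : forall k, d k = (enorm (p k))^-1 *: p k.
Hypothesis alpha_gt0 : forall k, 0 < alpha k.
Hypothesis x_step : forall k, x k.+1 = x k + alpha k *: d k.
Hypothesis Phi_step : forall k,
  Phi f (x k.+1) <= Phi f (x k) - 2^-1 * alpha k * enorm (p k).
Hypothesis armijo_fails : forall k i, alpha k < 1 -> f i (x k) = Phi f (x k) ->
  Phi f (x k) + alpha k * dot (g i (x k)) (d k) <=
  Phi f (x k + (2 * alpha k) *: d k).

(** Path length up to [x k], the [d k] being unit vectors. *)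
Let s k := \sum_(0 <= i < k) alpha i.

Let sS k : s k.+1 = s k + alpha k.
Proof. by rewrite /s big_nat_recr. Qed.

Let s_mono k m : (k <= m)%N -> s k <= s m.
Proof.
elim: m => [|m IH]; first by rewrite leqn0 => /eqP->.
rewrite leq_eqVlt => /predU1P[->//|/IH km].
by rewrite (le_trans km) // sS lerDl ltW.
Qed.

Let L_gt0 : 0 < L.
Proof. exact: lt_le_trans (le_trans (p_ge 0) (p_le 0)). Qed.

Let p_gt0 k : 0 < enorm (p k).
Proof. exact: lt_le_trans (p_ge k). Qed.

Let p_neq0 k : p k != 0.
Proof. by rewrite -enorm_eq0 gt_eqF. Qed.

Let d1 k : enorm (d k) = 1.
Proof. by rewrite dE enorm_normalize. Qed.

(** Each step lowers [Phi] by at least [eta / 2] times its length, and [Phi] is bounded below by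
    [M]. *)
Let s_cvg : exists S : R, s @ \oo --> S.
Proof.
apply/cvg_ex; apply: nondecreasing_is_cvgn => [k m|]; first exact: s_mono.
exists (2 / eta * (Phi f (x 0) - M)) => _ [k _ <-].
have h : eta / 2 * s k <= Phi f (x 0) - Phi f (x k).
  elim: k => [|k IH]; first by rewrite /s big_nil mulr0 subrr.
  rewrite sS mulrDr; have := Phi_step k.
  have : alpha k * eta <= alpha k * enorm (p k) by rewrite ler_pM2l.
  lra.
have := le_trans (f_ge ord0 (x k)) (Phi_ge f ord0 (x k)) => hM.
rewrite -(@ler_pM2l _ (eta / 2)) ?divr_gt0 // (le_trans h) //.
have -> : eta / 2 * (2 / eta * (Phi f (x 0) - M)) = Phi f (x 0) - M.
  by field; rewrite gt_eqF.
lra.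
Qed.

Let x_dist k m : (k <= m)%N -> enorm (x m - x k) <= s m - s k.
Proof.
elim: m => [|m IH]; first by rewrite leqn0 => /eqP->; rewrite !subrr enorm0.
rewrite leq_eqVlt => /predU1P[->|/IH km]; first by rewrite !subrr enorm0.
rewrite (le_trans (ler_enorm_dist (x m) _ _)) // x_step sS [x m + _]addrC addrK.
by rewrite enormZ d1 mulr1 gtr0_norm //; lra.
Qed.

Let f_lip j k m : `|f j (x k) - f j (x m)| <= L * enorm (x k - x m).
Proof.
have h a b : f j (x a) - f j (x b) <= L * enorm (x a - x b).
  have := tangent j (x a) (x b); have := dot_le (g j (x a)) (x a - x b).
  have : enorm (g j (x a)) * enorm (x a - x b) <= L * enorm (x a - x b).
    by rewrite ler_wpM2r ?enorm_ge0.
  rewrite -(opprB (x a) (x b)) dotNr; lra.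
by rewrite ler_norml h andbT lerNl opprB enormC h.
Qed.

Let p_dist k m r : enorm (x k - x m) <= r ->
  enorm (p k - p m) ^+ 2 <= 2 * L * (w r + r).
Proof.
move=> xr; have r0 : 0 <= r := le_trans (enorm_ge0 _) xr.
have wr : w (enorm (x k - x m)) <= w r by apply: mod_w.1 => //; exact: enorm_ge0.
have w0 : 0 <= w r by rewrite -mod_w.2.1; exact: mod_w.1.
apply: (@le_trans _ _ (w r * (enorm (p k) + enorm (p m)) + 2 * (L * r))).
  apply: p_stable => j; first exact: le_trans (g_w _ _ _) wr.
  by rewrite (le_trans (f_lip _ _ _)) // ler_wpM2l // ltW.
have : w r * (enorm (p k) + enorm (p m)) <= w r * (L + L).
  by rewrite ler_wpM2l // lerD.
lra.
Qed.

Lemma no_jamming : False.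
Proof.
have [S sS_cvg] := s_cvg.
(* Length of the path remaining after [x k]; it dominates both [alpha k] and the distance from [x k]
   to [xbar]. *)
pose T k := S - s k.
have T_cvg : T @ \oo --> 0.
  by rewrite -(subrr S); apply: cvgB => //; exact: cvg_cst.
have s_le k : s k <= S.
  by apply: cvg_nondecreasing_ge sS_cvg => m _; exact: s_mono.
have alpha_le k : alpha k <= T k by have := s_le k.+1; rewrite sS /T; lra.
have T_gt0 k : 0 < T k by exact: lt_le_trans (alpha_le k).
have T_mono k m : (k <= m)%N -> T m <= T k by move=> /s_mono; rewrite /T; lra.
have [xbar x_cvg] : exists y : 'cV[R]_n, x @ \oo --> y.
  by apply/cvg_ex; exact: enorm_cauchy_cvg x_dist sS_cvg.
have x_xbar k : enorm (x k - xbar) <= T k.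
  have c : enorm (x m - xbar) + T k @[m --> \oo] --> T k.
    rewrite -[X in _ --> X]add0r; apply: cvgD; last exact: cvg_cst.
    exact: cvg_enorm_sub.
  apply: (cvgr_to_ge c); exists k => // m /= km.
  rewrite (le_trans (ler_enorm_dist (x m) _ _)) // addrC lerD2l enormC.
  by rewrite (le_trans (x_dist _ _ km)) // /T; have := s_le m; lra.
pose y k := x k + (2 * alpha k) *: d k.
have xt_xbar k t : 0 <= t <= 2 * alpha k ->
    enorm (x k + t *: d k - xbar) <= 3 * T k.
  move=> /andP[t0 ta]; rewrite [x k + _]addrC -addrA.
  rewrite (le_trans (ler_enormD _ _)) // enormZ d1 mulr1 ger0_norm //.
  by have := x_xbar k; have := alpha_le k; lra.
have y_cvg : y @ \oo --> xbar.
  apply: (enorm_cvgP _ _ (fun k => 3 * T k)).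
    by move=> k; apply: xt_xbar; rewrite lexx andbT mulr_ge0 // ltW.
  by rewrite -[X in _ --> X](mulr0 3); apply: cvgM => //; exact: cvg_cst.
have alpha_cvg : alpha @ \oo --> 0.
  apply: (@squeeze_cvgr _ _ _ _ (fun=> 0) T) => //; last exact: cvg_cst.
  by near=> k; rewrite alpha_le ltW.
have Phi_cvg : Phi f (x k) @[k --> \oo] --> Phi f xbar.
  by apply: continuous_cvg x_cvg; exact: continuous_Phi.
have f_cvg j : f j (x k) @[k --> \oo] --> f j xbar.
  by apply: continuous_cvg x_cvg; exact: cont_f.
pose A j := f j xbar = Phi f xbar.
have nA j : ~ A j -> f j xbar - Phi f xbar < 0.
  by move=> nAj; rewrite subr_lt0 lt_neqAle Phi_ge andbT; apply/eqP.
(* Error unit: it yields [sl j >= eta - 2 * e = 8 * e], while the final estimate yields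
   [sl j <= 5 * e]. *)
pose e := eta / 10.
have e0 : 0 < e by rewrite divr_gt0.
pose L2 := L + \sum_j enorm (g j xbar).
have L2_ge j : enorm (g j xbar) <= L2.
  rewrite /L2 (bigD1 j) //=.
  have : 0 <= \sum_(i < N.+1 | i != j) enorm (g i xbar).
    by apply: sumr_ge0 => i _; exact: enorm_ge0.
  by have := L_gt0; lra.
have L2_gt0 : 0 < L2.
  by rewrite /L2 ltr_pwDl //; apply: sumr_ge0 => i _; exact: enorm_ge0.
(* Chosen so that normalizing vectors within [e1] of each other and of norm at least [eta] moves the
   directions by at most [e / 2 / L2]. *)
pose e1 := eta * (e / 2 / L2) / 2.
have e10 : 0 < e1 by rewrite !(divr_gt0, mulr_gt0).
have [r1 r10 hr1] := modulus_small _ _ mod_w (divr_gt0 e0 (@ltr0Sn R 1)).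
(* Chosen so that [p_dist] with [w r] and [r] at most [e2] gives exactly [e1 ^+ 2]. *)
pose e2 := e1 ^+ 2 / (2 * L) / 2.
have e20 : 0 < e2 by rewrite !(divr_gt0, mulr_gt0, exprn_gt0).
have [r2 r20 hr2] := modulus_small _ _ mod_w e20.
(* Besides the smallness of steps and remaining length, [K] makes functions inactive at [xbar]
   inactive at [x K] and too small at the trial point to cause a rejection. *)
have [K _ HK] : \forall k \near \oo, [/\ alpha k < 1, 3 * T k <= r1,
    T k <= r2, T k <= e2 & forall j,
    [/\ A j -> Phi f (x k) - f j (x k) <= e * eta,
     ~ A j -> f j (x k) < Phi f (x k) &
     ~ A j -> f j (y k) < Phi f (x k) - alpha k * L]].
  near=> k; split.
  - by near: k; exact: cvgr_lt alpha_cvg _ _.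
  - rewrite mulrC -ler_pdivlMr //; near: k.
    by apply: cvgr_le T_cvg _ _; rewrite divr_gt0.
  - by near: k; exact: cvgr_le T_cvg _ _.
  - by near: k; exact: cvgr_le T_cvg _ _.
  - near: k; apply: filter_forall => j.
    have [Aj|/[dup] nAj /nA Aj] := pselect (A j).
      near=> k; split=> // _; near: k.
      apply: (@cvgr_le _ _ _ _ _ (Phi f xbar - f j xbar)); first exact: cvgB.
      by rewrite Aj subrr mulr_gt0.
    near=> k; split=> // _; rewrite -subr_lt0; near: k.
      by apply: (@cvgr_lt _ _ _ _ _ (f j xbar - Phi f xbar)) => //; exact: cvgB.
    apply: (@cvgr_lt _ _ _ _ _ (f j xbar - (Phi f xbar - 0 * L))).
      apply: cvgB; first by apply: continuous_cvg y_cvg; exact: cont_f.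
      by apply: cvgB => //; apply: cvgM => //; exact: cvg_cst.
    by rewrite mul0r subr0.
have [aK1 TK1 TK2 TK3 HA] := HK _ (leqnn K).
have d_close k : (K <= k)%N -> enorm (d k - d K) <= e / 2 / L2.
  move=> Kk.
  have pe : enorm (p k - p K) <= e1.
    rewrite -(@ler_pXn2r _ 2) ?nnegrE ?enorm_ge0 ?(ltW e10) //.
    apply: (@le_trans _ _ (2 * L * (w (T K) + T K))).
      by apply: p_dist; rewrite (le_trans (x_dist _ _ Kk)) // /T; have := s_le k; lra.
    have wT : w (T K) <= e2 by apply: hr2; rewrite ltW.
    have -> : e1 ^+ 2 = 2 * L * (e2 + e2).
      by rewrite /e2; field; rewrite gt_eqF.
    by rewrite ler_pM2l ?mulr_gt0 //; exact: lerD.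
  rewrite !dE (le_trans (enorm_normalize_dist _ _ _ _)) // ler_pdivrMr //.
  apply: (@le_trans _ _ (2 * e1)); first by rewrite ler_pM2l.
  have -> : 2 * e1 = e / 2 / L2 * eta by rewrite /e1; field; rewrite gt_eqF.
  by rewrite ler_pM2l // !divr_gt0.
(* Rate of decrease of [f j] at [xbar] along [d K]; from [K] on, the slopes met along the path equal
   [- sl j] up to [e]. *)
pose sl j := - dot (g j xbar) (d K).
have slope j k t : (K <= k)%N -> 0 <= t <= 2 * alpha k ->
    `|dot (g j (x k + t *: d k)) (d k) + sl j| <= e.
  move=> Kk ht; set z := x k + t *: d k.
  have -> : dot (g j z) (d k) + sl j =
      dot (g j z - g j xbar) (d k) + dot (g j xbar) (d k - d K).
    by rewrite /sl dotBl dotBr; ring.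
  have b1 : `|dot (g j z - g j xbar) (d k)| <= e / 2.
    rewrite (le_trans (normr_dot_le _ _)) // d1 mulr1 (le_trans (g_w _ _ _)) //.
    apply: hr1; rewrite enorm_ge0 /= (le_trans (xt_xbar _ _ ht)) //.
    by rewrite (le_trans _ TK1) // ler_pM2l // T_mono.
  have b2 : `|dot (g j xbar) (d k - d K)| <= e / 2.
    rewrite (le_trans (normr_dot_le _ _)) //.
    apply: (@le_trans _ _ (L2 * (e / 2 / L2))).
      by rewrite ler_pM ?enorm_ge0 // d_close.
    by rewrite mulrC divfK // gt_eqF.
  by rewrite (le_trans (ler_normD _ _)) //; lra.
have slope0 j k : (K <= k)%N -> `|dot (g j (x k)) (d k) + sl j| <= e.
  move=> Kk; have := slope j k 0 Kk; rewrite scale0r addr0; apply.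
  by rewrite lexx mulr_ge0 // ltW.
have slope1 j k : (K <= k)%N -> `|dot (g j (x k.+1)) (d k) + sl j| <= e.
  move=> Kk; rewrite x_step; apply: slope => //.
  by have := alpha_gt0 k; lra.
(* The sequence [f j (x k) + (sl j + e) * s k] is nondecreasing from [K] on, by the tangent at the
   start of each step; its value at [K] is compared with its limit. *)
have f_upper j : f j (x K) - f j xbar <= (sl j + e) * T K.
  have c : f j (x k) + (sl j + e) * s k @[k --> \oo] -->
      f j xbar + (sl j + e) * S.
    by apply: cvgD => //; apply: cvgM => //; exact: cvg_cst.
  have := cvg_nondecreasing_ge _ _ K _ c; rewrite /T => h.
  suff : f j (x K) + (sl j + e) * s K <= f j xbar + (sl j + e) * S by lra.
  apply: h => k Kk; rewrite sS.
  have := tangent j (x k) (x k.+1).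
  rewrite [in x k.+1 - _]x_step [x k + _]addrC addrK dotZr.
  have := slope0 j k Kk; rewrite ler_norml => /andP[h1 _].
  have : 0 <= alpha k * (dot (g j (x k)) (d k) + sl j + e).
    by apply: mulr_ge0; [exact: ltW|lra].
  lra.
(* The mirror estimate uses the tangent at the end of each step. *)
have f_lower j : (sl j - e) * T K <= f j (x K) - f j xbar.
  have c : f j (x k) + (sl j - e) * s k @[k --> \oo] -->
      f j xbar + (sl j - e) * S.
    by apply: cvgD => //; apply: cvgM => //; exact: cvg_cst.
  have := cvg_nonincreasing_le _ _ K _ c; rewrite /T => h.
  suff : f j xbar + (sl j - e) * S <= f j (x K) + (sl j - e) * s K by lra.
  apply: h => k Kk; rewrite sS.
  have := tangent j (x k.+1) (x k).
  have -> : x k - x k.+1 = - alpha k *: d k.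
    by rewrite x_step opprD addrA subrr add0r scaleNr.
  rewrite dotZr; have := slope1 j k Kk; rewrite ler_norml => /andP[_ h1].
  have : alpha k * (dot (g j (x k.+1)) (d k) + sl j - e) <= 0.
    by rewrite pmulr_rle0 //; lra.
  lra.
have [i fi] := Phi_attained f (x K).
have [j fj] := Phi_attained f (y K).
have arm := armijo_fails K i aK1 (esym fi).
rewrite -/(y K) fj in arm.
have Ai : A i.
  have [_ h _] := HA i; apply: contrapT => /h; by rewrite fi ltxx.
(* Slopes are at least [- L], so the rejection forces the trial value to be at least
   [Phi f (x K) - alpha K * L]. *)
have Aj : A j.
  have [_ _ h] := HA j; apply: contrapT => /h.
  have : - (alpha K * L) <= alpha K * dot (g i (x K)) (d K).
    rewrite -mulrN ler_pM2l //.
    have := normr_dot_le (g i (x K)) (d K); rewrite d1 mulr1 ler_norml.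
    by have := g_le i K; lra.
  by rewrite ltNge; lra.
have trial : f j (y K) <= f j (x K) - 2 * alpha K * (sl j - e).
  have := tangent j (y K) (x K).
  have -> : x K - y K = - (2 * alpha K) *: d K.
    by rewrite /y opprD addrA subrr add0r scaleNr.
  rewrite dotZr; have := slope j K (2 * alpha K) (leqnn K).
  rewrite lexx andbT mulr_ge0 ?(ltW (alpha_gt0 K)) // => /(_ isT).
  rewrite -/(y K) ler_norml.
  move=> /andP[_ h1].
  have : 2 * alpha K * (dot (g j (y K)) (d K) + sl j - e) <= 0.
    by rewrite pmulr_rle0 ?mulr_gt0 //; lra.
  lra.
have slj : 8 * e <= sl j.
  have := p_slope j K; have [/(_ Aj) h1 _ _] := HA j.
  have pE : p K = enorm (p K) *: d K by rewrite dE scalerA mulfV ?scale1r // gt_eqF.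
  rewrite [in dot _ (p K)]pE dotZr.
  have := slope0 j K (leqnn K); rewrite ler_norml => /andP[h2 h2'] h3.
  have : enorm (p K) * (dot (g j (x K)) (d K) + enorm (p K) - e) <= 0.
    have : e * eta <= e * enorm (p K) by rewrite ler_pM2l.
    lra.
  by rewrite pmulr_rle0 // => h4; have := p_ge K; rewrite /e in h2 h4 *; lra.
have := f_lower i; have := f_upper j; rewrite Ai Aj => up low.
have slope_i : - (sl i + e) <= dot (g i (x K)) (d K).
  by have := slope0 i K (leqnn K); rewrite ler_norml; lra.
have arm2 : - (alpha K * (sl i + e)) <= alpha K * dot (g i (x K)) (d K).
  by rewrite -mulrN ler_pM2l.
have fjle := Phi_ge f j (x K).
(* Rejection together with [f j (x K) <= f i (x K)]; the sign of this quantity is what permits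
   replacing [alpha K] by the larger [T K]. *)
have q1 : 0 <= sl i - 2 * sl j + 3 * e.
  by rewrite -(@pmulr_rge0 _ (alpha K)) //; lra.
have : alpha K * (sl i - 2 * sl j + 3 * e) <= T K * (sl i - 2 * sl j + 3 * e).
  by rewrite ler_wpM2r.
move=> q2.
(* The terms in [sl i] cancel between the rejection, [f_lower i] and [f_upper j]. *)
have : T K * (sl j - 5 * e) <= 0 by lra.
by rewrite pmulr_rle0 //; lra.
Unshelve. all: by end_near. Qed.

End Jamming.

(** * Convergence of the iterates to the minimum point *)

Theorem theorem7 (R : realType) (n N : nat) (f : 'I_N.+1 -> 'cV[R]_n -> R)
  (M : R) (w : R -> R) (xstar : 'cV[R]_n) (x : nat -> 'cV[R]_n) :
  (* (H1) *)
  (forall j y, M <= f j y) ->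
  (* (H2): f_j in C^1 with gradients uniformly continuous with common modulus w *)
  (forall j y, differentiable (f j) y) ->
  (forall j, continuous (grad (f j))) ->
  modulus w ->
  (forall j y z, enorm (grad (f j) y - grad (f j) z) <= w (enorm (y - z))) ->
  (* strict convexity *)
  (forall j, strictly_convex (f j)) ->
  (* xstar is the global minimum point of Phi *)
  (forall y, Phi f xstar <= Phi f y) ->
  (* (x_k) generated by Algorithm X *)
  x 0%N = 0 ->
  (forall k, algX_step f (x k) (x k.+1)) ->
  x @ \oo --> xstar.
Proof.
move=> f_ge diff_f _ mod_w grad_w cvx_f min_Phi _ step.
have cont_f j : continuous (f j).
  by move=> y; exact: differentiable_continuous (diff_f j y).
have growth := strictly_convex_growth (Phi f) xstar (continuous_Phi f cont_f)
  (strictly_convex_Phi f cvx_f) min_Phi.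
have [lam lamP] := choice (fun k =>
  algX_stepP f diff_f cvx_f w mod_w grad_w (x k) (x k.+1) (step k)).
have qlam k : qp_solution (Gmat f (x k)) (fvec f (x k)) (lam k).
  by have [] := lamP k.
pose p k := search_dir f (x k) (lam k).
have Phi_dec k : Phi f (x k.+1) <= Phi f (x k).
  have [_ p0 pn0] := lamP k; have [/p0->//|/pn0[a [a0 _ h _]]] := eqVneq (p k) 0.
  rewrite (le_trans h) // gerBl mulr_ge0 ?enorm_ge0 // mulr_ge0 //; exact: ltW.
have Phi_mono k m : (k <= m)%N -> Phi f (x m) <= Phi f (x k).
  elim: m => [|m IH]; first by rewrite leqn0 => /eqP->.
  rewrite leq_eqVlt => /predU1P[->//|/IH km]; exact: le_trans (Phi_dec m) km.
(* Values come arbitrarily close to the minimum, hence stay close by monotonicity; growth at radius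
   [e] then forces the iterates within [e] of [xstar]. *)
suff key delta : 0 < delta -> exists k, Phi f (x k) - Phi f xstar < delta.
  apply/cvgrPdist_lt => e e0; have [m m0 hm] := growth e e0.
  have [K hK] := key _ (mulr_gt0 m0 e0); exists K => // k /= Kk.
  rewrite distrC ltNge; apply/negP => ek.
  have := hm _ ek; have := Phi_mono _ _ Kk.
  have : m * e <= m * `|x k - xstar| by rewrite ler_pM2l.
  lra.
move=> delta0; apply: contrapT => nk.
have gap k : delta <= Phi f (x k) - Phi f xstar.
  by rewrite leNgt; apply/negP => h; apply: nk; exists k.
have [m m0 hm] := growth 1 ltr01.
(* Growth at radius 1 bounds the initial level set, which contains all iterates. *)
pose b := 1 + (Phi f (x 0) - Phi f xstar) / m.
have xb k : `|x k - xstar| <= b.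
  have c0 : 0 <= (Phi f (x 0) - Phi f xstar) / m.
    by rewrite divr_ge0 ?subr_ge0 // ltW.
  have [h|h] := ltP `|x k - xstar| 1; first by rewrite /b; lra.
  suff : `|x k - xstar| <= (Phi f (x 0) - Phi f xstar) / m by rewrite /b; lra.
  rewrite ler_pdivlMr // mulrC (le_trans (hm _ h)) // lerD2r.
  exact: Phi_mono.
(* The factor [n] passes from the sup norm to the Euclidean one; the added 1 keeps [B] positive even
   when [n = 0]. *)
pose B := n%:R * b + 1.
have xB k : enorm (x k - xstar) <= B.
  rewrite (le_trans (enorm_le_norm _)) // /B.
  by have := ler_wpM2l (ler0n R n) (xb k); lra.
have B0 : 0 < B.
  by rewrite ltr_pwDr // mulr_ge0 // (le_trans _ (xb 0)).
pose L := \sum_j enorm (grad (f j) xstar) + w B.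
have gL j k : enorm (grad (f j) (x k)) <= L.
  have h1 := grad_w j (x k) xstar.
  have h2 : w (enorm (x k - xstar)) <= w B.
    by apply: mod_w.1 => //; exact: enorm_ge0.
  have h3 : enorm (grad (f j) xstar) <= \sum_j enorm (grad (f j) xstar).
    rewrite (bigD1 j) //= lerDl; apply: sumr_ge0 => i _; exact: enorm_ge0.
  have := ler_enormD (grad (f j) (x k) - grad (f j) xstar) (grad (f j) xstar).
  rewrite subrK /L => h4; apply: (le_trans h4); rewrite addrC.
  exact: lerD h3 (le_trans h1 h2).
have L0 : 0 <= L := le_trans (enorm_ge0 _) (gL ord0 0).
have LB0 : 0 < L + B by rewrite ltr_wpDl.
(* The lower bound [eta] comes from [Phi_gap] at [xstar], whose left side is at least [delta]. *)
have p_ge k : delta / (L + B) <= enorm (p k).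
  rewrite ler_pdivrMr // (le_trans (gap k)) //.
  apply: (le_trans (Phi_gap f diff_f cvx_f _ _ _ _ (qlam k) (gL^~ k))).
  by rewrite ler_wpM2l ?enorm_ge0 // lerD2l enormC.
have eta0 : 0 < delta / (L + B) by rewrite divr_gt0.
have p_neq0 k : p k != 0 by rewrite -enorm_eq0 gt_eqF // (lt_le_trans eta0).
have [alpha alphaP] := choice (fun k =>
  let: And3 _ _ h := lamP k in h (p_neq0 k)).
apply: (@no_jamming R n N f (fun j => grad (f j)) w M L (delta / (L + B)) x p
  (fun k => (enorm (p k))^-1 *: p k) alpha) => //.
- by move=> j y z; exact: convex_ge_tangent.
- move=> k; have [[l0 l1] _] := qlam k.
  by rewrite /p search_dirE enormN; apply: enorm_sum_le l0 l1 (gL^~ k).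
- move=> j k; apply: (le_trans (search_dir_slope f _ _ j (qlam k))).
  by rewrite lerD2r; apply: dot_fvec_le; exact: (qlam k).1.
- by move=> k l a c ga fc; exact: search_dir_stable.
- by move=> k; have [] := alphaP k.
- by move=> k; have [] := alphaP k.
- by move=> k; have [] := alphaP k.
- by move=> k i a1 fi; have [_ _ _ h] := alphaP k; exact: h.
Qed.
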